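(* The spectrum of nim numbers of sums of avoidance games with $\tau(W)\subseteq\mathrm{Ex}(S)$ is $\{0,1\}$; that is, the set of all values $\mathrm{nim}(G_1+G_2)$, where each $G_i=\mathrm{DNG}(S_i,W_i)$ is an avoidance game on a convex geometry $(S_i,\mathcal{K}_i)$ with $W_i\subseteq S_i$ nonempty and $\tau_i(W_i)\subseteq\mathrm{Ex}(S_i)$, equals $\{0,1\}$. Here $\tau_i$ is the convex closure operator of $(S_i,\mathcal{K}_i)$.
   Context: A convex geometry is a pair $(S,\mathcal{K})$ with $S$ a finite set and $\mathcal{K}$ a family of subsets of $S$ such that: (1) $S\in\mathcal{K}$; (2) $K,L\in\mathcal{K}$ implies $K\cap L\in\mathcal{K}$; (3) if $S\neq K\in\mathcal{K}$, then there is $a\in S\setminus K$ with $K\cup\{a\}\in\mathcal{K}$. The convex closure operator is $\tau(A)=\bigcap\{K\in\mathcal{K}\mid A\subseteq K\}$ for $A\subseteq S$. A point $a\in A$ is an extreme point of $A$ if $a\notin\tau(A\setminus\{a\})$; $\mathrm{Ex}(A)$ is the set of extreme points of $A$. Avoidance game $\mathrm{DNG}(S,W)$, for nonempty $W\subseteq S$: two players alternately choose previously unchosen points of $S$, starting from the empty set of chosen points; a player may choose a point only if, with $P$ the set of all jointly chosen points after the move, $W\not\subseteq\tau(P)$. The last player able to move wins. The nim number of a position $P$ of an impartial game is defined recursively by $\mathrm{nim}(P)=\mathrm{mex}\{\mathrm{nim}(Q)\mid Q\in\mathrm{Opt}(P)\}$, where $\mathrm{Opt}(P)$ is the set of positions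 reachable from $P$ in one legal move and $\mathrm{mex}(A)$ is the smallest nonnegative integer not in $A$; the nim number of a game is that of its starting position. The sum $P+R$ of two games has options $\mathrm{Opt}(P+R)=\{Q+R\mid Q\in\mathrm{Opt}(P)\}\cup\{P+U\mid U\in\mathrm{Opt}(R)\}$. *)

(* Defs.v *)
From HB Require Import structures.
From mathcomp Require Import all_boot.
From Stdlib Require Import Wellfounded.

Set Implicit Arguments.
Unset Strict Implicit.
Unset Printing Implicit Defensive.

(* The ground set S is the whole finite type T, i.e. [set: T]. *)
Record convexGeometry (T : finType) := ConvexGeometry {
  convex :> {set {set T}};
  convexT : [set: T] \in convex;
  convexI : forall K L, K \in convex -> L \in convex -> K :&: L \in convex;
  convex_extend : forall K, K \in convex -> K != [set: T] ->
    exists2 a, a \notin K & a |: K \in convex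
}.

Section ConvexGeometry.
Variables (T : finType) (G : convexGeometry T).

Definition tau (A : {set T}) : {set T} :=
  \bigcap_(K in convex G | A \subset K) K.

Definition Ex (A : {set T}) : {set T} := [set a in A | a \notin tau (A :\ a)].

End ConvexGeometry.

Lemma mex_subproof (s : seq nat) : exists n, n \notin s.
Proof.
exists (\max_(n <- s) n).+1; apply/negP => s_max.
have := leq_bigmax_seq (F := id) (P := xpredT) _ s_max isT.
by rewrite ltnn.
Qed.

Definition mex (s : seq nat) : nat := ex_minn (mex_subproof s).

(* Finite impartial games in which every play terminates. The type of          *)
(* positions may contain positions that are unreachable from [start].          *)
Record game := Game {
  position : finType;
  start : position;
  options : position -> {set position};
  options_wf : well_founded (fun q p => q \in options p)
}.

Definition nim_pos (G : game) : position G -> nat :=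
  Fix (@options_wf G) (fun _ => nat)
    (fun p nim_rec =>
       mex [seq nim_rec (val q) (valP q) | q : {q | q \in options p}]).

Definition nim (G : game) : nat := nim_pos (start G).

Lemma eq_mex (s t : seq nat) : s =i t -> mex s = mex t.
Proof.
move=> st; rewrite /mex; case: ex_minnP => m ms m_min.
case: ex_minnP => n nt n_min; apply/eqP; rewrite eqn_leq.
by rewrite m_min ?st // n_min -?st.
Qed.

Lemma nim_posE (G : game) (p : position G) :
  nim_pos p = mex [seq nim_pos q | q in options p].
Proof.
rewrite {1}/nim_pos Fix_eq; last first.
  by move=> x f g fg; congr mex; apply: eq_map => q; apply: fg.
apply: eq_mex => n; apply/imageP/imageP => [[q _ ->]|[q qp ->]].
  by exists (val q); first exact: valP.
by exists (exist _ q qp).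
Qed.

Section Sum.
Variables G H : game.

Definition sum_options (p : position G * position H) :
    {set position G * position H} :=
  [set (q, p.2) | q in options p.1] :|: [set (p.1, u) | u in options p.2].

Lemma sum_options_wf : well_founded (fun q p => q \in sum_options p).
Proof.
move=> [p r]; elim/(well_founded_ind (@options_wf G)): p r => p IHp r.
elim/(well_founded_ind (@options_wf H)): r => r IHr.
constructor=> _ /setUP[] /imsetP[q /= q_opt ->]; first exact: IHp.
exact: IHr.
Qed.

Definition sum_game : game := @Game _ (start G, start H) _ sum_options_wf.

End Sum.

Section Avoidance.
Variables (T : finType) (G : convexGeometry T) (W : {set T}).

(* A position is the set of jointly chosen points. *)
Definition DNG_options (P : {set T}) : {set {set T}} :=
  [set a |: P | a in [set a | a \notin P & ~~ (W \subset tau G (a |: P))]].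

Lemma DNG_options_wf : well_founded (fun Q P => Q \in DNG_options P).
Proof.
apply: (@wf_incl _ _ (fun Q P : {set T} => (#|~: Q| < #|~: P|)%coq_nat)).
  move=> Q P /imsetP[a]; rewrite inE => /andP[aP _] ->; apply/ltP.
  apply: proper_card; rewrite properC; apply/properP; split.
    exact: subsetUr.
  by exists a; rewrite ?setU11.
exact: (wf_inverse_image _ _ _ (fun P : {set T} => #|~: P|) PeanoNat.Nat.lt_wf_0).
Qed.

Definition DNG : game := @Game _ set0 _ DNG_options_wf.

End Avoidance.

(* Main.v *)
Require Import Defs.
From HB Require Import structures.
From mathcomp Require Import all_boot.

Set Implicit Arguments.
Unset Strict Implicit.
Unset Printing Implicit Defensive.

(** A point of [Ex S] can only be in the closure of a set that contains it, so
    for [W] inside [Ex S] a position [P] is legal exactly when [W] is not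
    contained in [P] ([extreme_sub_tau]). The players may thus take every point
    but one: as long as two points are free, a player can spare one free point
    of [W] and take the other. Hence every play from a legal position [P] lasts
    [#|~: P| - 1] moves, whatever the players do.

    In a game where the parity of the remaining play length is forced, the nim
    number is that parity ([nim_pos_parity]), and forced parities add up in a
    sum of games ([sum_forced_parity]). A sum of two games of the kind above
    therefore has for nim number the parity of [(#|S1| - 1) + (#|S2| - 1)]
    ([nim_sum_DNG]), which is 0 or 1; both occur already for sets of one or two
    points all of whose subsets are convex. *)

(** Inside the class [I] of positions, which moves do not leave, [b] is the
    parity of the number of moves still to be played: each move flips it, and
    play cannot stop where it is odd. *)
Definition forced_parity (G : game) (I b : pred (position G)) : Prop :=
  forall p, I p ->
    (forall q, q \in options p -> I q /\ b q = ~~ b p)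
    /\ (b p -> options p != set0).

Lemma mexP (s : seq nat) (n : nat) :
  n \notin s -> (forall m, m < n -> m \in s) -> mex s = n.
Proof.
move=> ns lt_s; rewrite /mex; case: ex_minnP => m ms m_min.
apply/eqP; rewrite eqn_leq m_min //= leqNgt.
by apply: contra ms => /lt_s.
Qed.

(** By induction all options have nim number [~~ b p]; if this is 1, or if
    there are no options, 0 is missing among them, and otherwise 0 is attained
    and 1 is missing. *)
Lemma nim_pos_parity (G : game) (I b : pred (position G)) (p : position G) :
  forced_parity I b -> I p -> nim_pos p = b p.
Proof.
move=> par; elim/(well_founded_ind (@options_wf G)): p => p IHp Ip.
have [step live] := par p Ip.
have val_opt q : q \in options p -> nim_pos q = ~~ b p.
  by move=> qp; have [Iq <-] := step q qp; apply: IHp.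
rewrite nim_posE; apply: mexP => [|m].
  apply/imageP => -[q qp].
  by rewrite val_opt //; case: (b p).
case bp: (b p) => //; rewrite ltnS leqn0 => /eqP->.
have /set0Pn[q qp] := live bp.
by apply/imageP; exists q; rewrite // val_opt // bp.
Qed.

Lemma sum_forced_parity (G H : game) (I b : pred (position G))
    (J c : pred (position H)) :
  forced_parity I b -> forced_parity J c ->
  @forced_parity (sum_game G H) (fun p => I p.1 && J p.2)
    (fun p => b p.1 (+) c p.2).
Proof.
move=> parG parH [p r] /= /andP[Ip Jr].
have [stepG liveG] := parG p Ip; have [stepH liveH] := parH r Jr.
split=> [_ /setUP[] /imsetP[q /= q_opt ->]|odd_pr].
- by have [-> ->] := stepG q q_opt; rewrite Jr addNb.
- by have [-> ->] := stepH q q_opt; rewrite Ip addbN.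
apply/set0Pn; move: odd_pr => /=; case bp: (b p) => /= cr.
  have /set0Pn[q q_opt] := liveG bp.
  by exists (q, r); apply/setUP; left; apply/imsetP; exists q.
have /set0Pn[q q_opt] := liveH cr.
by exists (p, q); apply/setUP; right; apply/imsetP; exists q.
Qed.

Section ExtremeAvoidance.
Variables (T : finType) (K : convexGeometry T).

Lemma sub_tau (A : {set T}) : A \subset tau K A.
Proof. by apply/bigcapsP => L /andP[]. Qed.

Lemma tau_mono (A B : {set T}) : A \subset B -> tau K A \subset tau K B.
Proof.
move=> AB; apply/bigcapsP => L /andP[LK BL].
by apply: bigcap_inf; rewrite LK (subset_trans AB).
Qed.

(** If [P] misses [w], then [P] lies in the complement of [w], whose closure
    misses [w] because [w] is extreme. *)
Lemma extreme_in_tau (w : T) (P : {set T}) :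
  w \in Ex K [set: T] -> (w \in tau K P) = (w \in P).
Proof.
rewrite inE => /andP[_ w_ex]; apply/idP/idP; last exact/subsetP/sub_tau.
apply: contraLR => wP; apply: contra w_ex; apply/subsetP/tau_mono.
by rewrite subsetD1 subsetT.
Qed.

Variable W : {set T}.
Hypothesis W_ex : W \subset Ex K [set: T].

Lemma extreme_sub_tau (P : {set T}) : (W \subset tau K P) = (W \subset P).
Proof.
apply/subsetP/subsetP => WP w wW; have := WP w wW;
  by rewrite extreme_in_tau // (subsetP W_ex).
Qed.

(** The remaining play length is [#|~: P| - 1], which is odd when [#|~: P|] is
    even; a legal position leaves a point of [W] free, so an even [#|~: P|] is
    at least 2. *)
Lemma DNG_forced_parity :
  @forced_parity (DNG K W) (fun P : {set T} => ~~ (W \subset P))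
    (fun P : {set T} => ~~ odd #|~: P|).
Proof.
move=> P WP; split=> [Q /imsetP[a]|evenP].
  rewrite inE extreme_sub_tau => /andP[aP WaP] ->; split=> //.
  by rewrite (cardsD1 a (~: P)) !inE aP setCU setIC -setDE /= negbK.
have /subsetPn[w wW wP] := WP.
have: odd #|~: P :\ w|.
  by move: evenP; rewrite (cardsD1 w) inE wP /= negbK.
move=> /odd_gt0/card_gt0P[a]; rewrite !inE => /andP[a_w aP].
apply/set0Pn; exists (a |: P); apply/imsetP; exists a => //.
rewrite inE aP extreme_sub_tau /=; apply/subsetPn; exists w => //.
by rewrite !inE negb_or eq_sym a_w.
Qed.

End ExtremeAvoidance.

(** The parity of [(#|S1| - 1) + (#|S2| - 1)] is that of [#|S1| + #|S2|]. *)
Lemma nim_sum_DNG (S1 S2 : finType)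
    (K1 : convexGeometry S1) (K2 : convexGeometry S2)
    (W1 : {set S1}) (W2 : {set S2}) :
  W1 != set0 -> W2 != set0 ->
  W1 \subset Ex K1 [set: S1] -> W2 \subset Ex K2 [set: S2] ->
  nim (sum_game (DNG K1 W1) (DNG K2 W2)) = odd (#|S1| + #|S2|).
Proof.
move=> W1n0 W2n0 W1_ex W2_ex.
have par := sum_forced_parity (DNG_forced_parity W1_ex)
  (DNG_forced_parity W2_ex).
rewrite /nim (nim_pos_parity par) /= ?subset0 ?W1n0 //.
by rewrite !setC0 !cardsT oddD addNb addbN negbK.
Qed.

Section PowersetGeometry.
Variable T : finType.

Fact powerset_convexT : [set: T] \in [set: {set T}].
Proof. exact: in_setT. Qed.

Fact powerset_convexI (K L : {set T}) :
  K \in [set: {set T}] -> L \in [set: {set T}] -> K :&: L \in [set: {set T}].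
Proof. by move=> _ _; exact: in_setT. Qed.

Fact powerset_convex_extend (K : {set T}) :
  K \in [set: {set T}] -> K != [set: T] ->
  exists2 a, a \notin K & a |: K \in [set: {set T}].
Proof.
move=> _; rewrite -subTset => /subsetPn[a _ aK].
by exists a; rewrite ?inE.
Qed.

Definition powerset_geometry : convexGeometry T :=
  ConvexGeometry powerset_convexT powerset_convexI powerset_convex_extend.

Lemma powerset_Ex : Ex powerset_geometry [set: T] = [set: T].
Proof.
apply/setP => a; rewrite !inE /=; apply/negP => /bigcapP/(_ ([set: T] :\ a)).
by rewrite !inE subxx eqxx => /(_ isT).
Qed.

End PowersetGeometry.

Theorem proposition25 (n : nat) :
  (exists (S1 S2 : finType)
          (K1 : convexGeometry S1) (K2 : convexGeometry S2)
          (W1 : {set S1}) (W2 : {set S2}),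
     [/\ W1 != set0, W2 != set0,
         tau K1 W1 \subset Ex K1 [set: S1],
         tau K2 W2 \subset Ex K2 [set: S2]
       & nim (sum_game (DNG K1 W1) (DNG K2 W2)) = n])
  <-> (n = 0 \/ n = 1).
Proof.
split=> [[S1 [S2 [K1 [K2 [W1 [W2 [W1n0 W2n0 W1_ex W2_ex <-]]]]]]]|n01].
  rewrite nim_sum_DNG //; first by case: odd; [right | left].
    exact: subset_trans (sub_tau _ _) W1_ex.
  exact: subset_trans (sub_tau _ _) W2_ex.
have realize (S1 S2 : finType) (x1 : S1) (x2 : S2) :
    odd (#|S1| + #|S2|) = n :> nat ->
    exists (S1 S2 : finType)
           (K1 : convexGeometry S1) (K2 : convexGeometry S2)
           (W1 : {set S1}) (W2 : {set S2}),
     [/\ W1 != set0, W2 != set0,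
         tau K1 W1 \subset Ex K1 [set: S1],
         tau K2 W2 \subset Ex K2 [set: S2]
       & nim (sum_game (DNG K1 W1) (DNG K2 W2)) = n].
  move=> <-; exists S1, S2, (powerset_geometry S1), (powerset_geometry S2).
  exists [set: S1], [set: S2].
  have W1n0 : [set: S1] != set0 by apply/set0Pn; exists x1.
  have W2n0 : [set: S2] != set0 by apply/set0Pn; exists x2.
  by split; rewrite ?nim_sum_DNG // powerset_Ex ?subsetT.
case: n01 => n_eq; subst n.
  by apply: (realize unit unit tt tt); rewrite card_unit.
by apply: (realize unit bool tt true); rewrite card_unit card_bool.
Qed.
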